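(* Let $G=(V,E)$ be a simple, connected, undirected graph on $n$ vertices with at least one edge. Then $G$ is totally conformally rigid if and only if it is edge-rigid.
   Context: For $ab\in E$ let $z_{ab}=e_a-e_b\in\mathbb{R}^V$ and $L_{ab}=z_{ab}z_{ab}^T$. For $w\in\mathbb{R}^E$ let $\mathcal{L}(w)=\sum_{ab\in E}w_{ab}L_{ab}$, and $L=\mathcal{L}(\mathbf{1})$ where $\mathbf{1}\in\mathbb{R}^E$ is the all-ones vector. Let $\Delta_E=\{w\in\mathbb{R}^E: w\ge 0,\ \mathbf{1}^Tw=|E|\}$. Order the eigenvalues of $\mathcal{L}(w)$ as $0=\lambda_1(w)\le\lambda_2(w)\le\dots\le\lambda_n(w)$; for $k\in\{1,\dots,n-1\}$ let $S_k(w)$ (resp. $s_k(w)$) be the sum of the $k$ largest (resp. $k$ smallest) among $\lambda_2(w),\dots,\lambda_n(w)$. $G$ is $k$-conformally rigid if $s_k(w)\le s_k(\mathbf{1})$ and $S_k(\mathbf{1})\le S_k(w')$ for all $w,w'\in\Delta_E$; totally conformally rigid if it is $k$-conformally rigid for all $k\in\{1,\dots,n-1\}$. Define $\mathcal{L}^*(X)_{ab}=X_{aa}+X_{bb}-2X_{ab}$ for symmetric $X$. With the spectral decomposition $L=\sum_{i=1}^r\lambda_iE_i$ (distinct eigenvalues $0=\lambda_1<\dots<\lambda_r$, orthogonal eigenprojectors $E_i$), $G$ is edge-rigid if for every $i\in\{2,\dots,r\}$ there is $\gamma_i>0$ with $\mathcal{L}^*(E_i)=\gamma_i\mathbf{1}$.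 *)

(* Defs.v *)
From HB Require Import structures.
From mathcomp Require Import all_boot all_order all_algebra.
From mathcomp Require Import reals polyrcf.

Set Implicit Arguments.
Unset Strict Implicit.
Unset Printing Implicit Defensive.

Import Order.TTheory GRing.Theory Num.Theory.
Local Open Scope ring_scope.

Section Spectrum.
Variables (R : realType) (n : nat).
Implicit Types (A X : 'M[R]_n) (x : R).

(* [rootsR] lists the distinct real roots of a polynomial in increasing order;
   a real symmetric matrix has only real eigenvalues. *)
Definition distinct_eigenvalues A : seq R := rootsR (char_poly A).

(* The eigenvalues in nondecreasing order, repeated with multiplicity. *)
Definition spectrum A : seq R :=
  flatten [seq nseq (mup x (char_poly A)) x | x <- distinct_eigenvalues A].

(* The orthogonal projector onto the eigenspace of x.  As [eigenspace] is a row
   space, this is the projection along {u | u U^T = 0}; for symmetric A left and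
   right eigenvectors agree up to transposition and the projector is
   symmetric. *)
Definition eigenprojector A x : 'M[R]_n :=
  let U := eigenspace A x in proj_mx U (kermx U^T).

End Spectrum.

Section Graph.
Variables (R : realType) (n : nat) (e : rel 'I_n).

(* The edges of the undirected graph with symmetric adjacency relation e: each
   edge ab is represented once, by its endpoints in increasing order.  All
   quantities below are symmetric in the two endpoints. *)
Definition edge : finType := {p : 'I_n * 'I_n | (p.1 < p.2)%N && e p.1 p.2}.

Definition src (ab : edge) : 'I_n := (val ab).1.
Definition tgt (ab : edge) : 'I_n := (val ab).2.

Definition edge_vec (ab : edge) : 'cV[R]_n :=
  delta_mx (src ab) 0 - delta_mx (tgt ab) 0.

Definition edge_laplacian (ab : edge) : 'M[R]_n :=
  edge_vec ab *m (edge_vec ab)^T.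

Definition laplacian (w : {ffun edge -> R}) : 'M[R]_n :=
  \sum_(ab : edge) w ab *: edge_laplacian ab.

Definition all_ones : {ffun edge -> R} := [ffun => 1].

Definition weight_simplex (w : {ffun edge -> R}) : Prop :=
  (forall ab, 0 <= w ab) /\ \sum_(ab : edge) w ab = #|{: edge}|%:R.

(* The index i is 1-based: lambda w 1 <= ... <= lambda w n. *)
Definition lambda (w : {ffun edge -> R}) (i : nat) : R :=
  (spectrum (laplacian w))`_i.-1.

(* For 1 <= k <= n - 1: the sums of the k smallest and of the k largest among
   lambda w 2, ..., lambda w n. *)
Definition sum_smallest (k : nat) (w : {ffun edge -> R}) : R :=
  \sum_(2 <= i < k.+2) lambda w i.

Definition sum_largest (k : nat) (w : {ffun edge -> R}) : R :=
  \sum_((n - k).+1 <= i < n.+1) lambda w i.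

Definition conformally_rigid (k : nat) : Prop :=
  forall w w' : {ffun edge -> R}, weight_simplex w -> weight_simplex w' ->
    sum_smallest k w <= sum_smallest k all_ones /\
    sum_largest k all_ones <= sum_largest k w'.

Definition totally_conformally_rigid : Prop :=
  forall k : nat, (1 <= k <= n.-1)%N -> conformally_rigid k.

Definition laplacian_adjoint (X : 'M[R]_n) : {ffun edge -> R} :=
  [ffun ab => X (src ab) (src ab) + X (tgt ab) (tgt ab)
              - 2 * X (src ab) (tgt ab)].

(* The i-th (1-based) distinct eigenvalue; for a nonempty graph the first one
   is 0. *)
Definition distinct_lambda (i : nat) : R :=
  (distinct_eigenvalues (laplacian all_ones))`_i.-1.

Definition edge_rigid : Prop :=
  forall i : nat,
    (2 <= i <= size (distinct_eigenvalues (laplacian all_ones)))%N ->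
    exists gamma : R, 0 < gamma /\
      laplacian_adjoint (eigenprojector (laplacian all_ones) (distinct_lambda i))
      = [ffun ab => gamma * all_ones ab].

End Graph.

(* Main.v *)
Require Import Defs.
From mathcomp Require Import all_boot all_order all_algebra.
From mathcomp Require Import reals.
From mathcomp Require Import perm spectral polyrcf complex ring lra zify.

Set Implicit Arguments.
Unset Strict Implicit.
Unset Printing Implicit Defensive.

Import Order.TTheory GRing.Theory Num.Theory.
Local Open Scope ring_scope.

(* On the simplex the trace of L(w) is constant and its least eigenvalue is 0,
   so both halves of k-conformal rigidity, over all k, amount to: for every k
   the sum S_k of the k largest eigenvalues is minimal at the all-ones weight.
   Everything is read off Ky Fan's principle
     S_k(A) = max { tr(XA) : 0 <= X <= 1, tr X = k }.

   If G is edge-rigid, diagonalize L in an orthonormal basis (q_i) and let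
   c_i = q_i L(w) q_i^T.  Averaging c over each eigenvalue class of L gives the
   spectrum of L, so S_k(L) is a combination of the c_i with coefficients in
   [0, 1] of sum k, i.e. tr(X L(w)) with X admissible in Ky Fan's principle.

   Conversely, if k is such that L has a gap between its k largest eigenvalues
   and the others, then S_k is differentiable at L, with gradient the projector
   F_k onto the top eigenspaces.  Minimality in the directions e_ab - e_cd makes
   the adjoint of F_k constant on edges, and each eigenprojector is a difference
   of two such F_k. *)

(** * Spectral theorem for real symmetric matrices *)

(** Over [R[i]] an eigenvalue a with eigenvector v exists; evaluating v A v^* in two ways gives a =
    a^*, so a is real. *)
Lemma symmetric_eigenvalue (R : rcfType) n (A : 'M[R]_n) :
  (0 < n)%N -> A^T = A -> exists x, eigenvalue A x.
Proof.
move=> n_gt0 Asym; pose f := real_complex R; pose B := map_mx f A.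
have [a aP] := @eigenvalue_closed _ n B n_gt0.
have /eigenvalueP[v vB v_neq0] := aP.
pose c := map_mx (@Num.conj R[i]) v.
have cB : c *m B = a^* *: c.
  have -> : B = map_mx Num.conj B.
    by apply/matrixP=> i j; rewrite !mxE; apply/eqP; rewrite eq_complex /= oppr0 !eqxx.
  by rewrite /c -map_mxM vB map_mxZ.
have Bc : B *m c^T = a^* *: c^T.
  have BT : B = B^T by rewrite /B map_trmx Asym.
  by rewrite BT -trmx_mul cB linearZ.
have vc_neq0 : (v *m c^T) 0 0 != 0.
  have -> : (v *m c^T) 0 0 = \sum_k `|v 0 k| ^+ 2.
    by rewrite mxE; apply: eq_bigr => k _; rewrite !mxE -normCK.
  apply: contra v_neq0 => /eqP sum0; apply/eqP/rowP => j.
  have /(_ j isT) := psumr_eq0P (fun k _ => exprn_ge0 2 (normr_ge0 (v 0 k))) sum0.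
  by move/eqP; rewrite sqrf_eq0 normr_eq0 => /eqP->; rewrite mxE.
have aa : a = a^*.
  apply: (mulIf vc_neq0).
  have : (v *m B) *m c^T = v *m (B *m c^T) by rewrite mulmxA.
  by rewrite vB Bc -scalemxAl -scalemxAr => /matrixP/(_ 0 0); rewrite !mxE.
have {aa} [x ax] : exists x, a = f x.
  exists (complex.Re a); case: (a) aa => p q /eqP; rewrite eq_complex /= => /andP[_].
  by rewrite -addr_eq0 -mulr2n mulrn_eq0 /= => /eqP->.
exists x; move: aP; rewrite !eigenvalue_root_char ax -map_char_poly /=.
by rewrite fmorph_root.
Qed.

(* The reflection exchanging e_0 and v. *)
Lemma orthogonal_completion (R : rcfType) n (v : 'rV[R]_(1 + n)) :
  v *m v^T = 1%:M -> exists H : 'M[R]_(1 + n), H *m H^T = 1%:M /\ row 0 H = v.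
Proof.
move=> vv; pose e0 : 'rV[R]_(1 + n) := delta_mx 0 0.
have [ev|/eqP nev] := eqVneq e0 v.
  exists 1%:M; split; first by rewrite trmx1 mulmx1.
  by rewrite rowE mulmx1.
pose u := e0 - v.
have ee : e0 *m e0^T = 1%:M.
  by rewrite trmx_delta mul_delta_mx; apply/matrixP=> i j; rewrite !mxE !ord1.
have ev : e0 *m v^T = (v 0 0)%:M.
  by rewrite -rowE; apply/matrixP=> i j; rewrite !mxE !ord1.
have ve : v *m e0^T = (v 0 0)%:M by rewrite -[LHS]trmxK trmx_mul trmxK ev tr_scalar_mx.
have uu : u *m u^T = (2 * (1 - v 0 0))%:M.
  rewrite /u linearB /= mulmxBl !mulmxBr ee ev ve vv -!rmorphB /=; congr _%:M; ring.
have eu : e0 *m u^T = (1 - v 0 0)%:M.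
  by rewrite /u linearB /= mulmxBr ee ev -rmorphB.
have nz : 1 - v 0 0 != 0.
  apply/eqP=> z; apply: nev; apply/eqP; rewrite -subr_eq0 -/u; apply/eqP.
  have sum0 : \sum_k u 0 k ^+ 2 = 0.
    have -> : \sum_k u 0 k ^+ 2 = (u *m u^T) 0 0.
      by rewrite [RHS]mxE; apply: eq_bigr => k _; rewrite [u^T _ _]mxE expr2.
    by rewrite uu z mulr0 mxE mul0rn.
  apply/rowP => j; have /(_ j isT) := psumr_eq0P (fun k _ => sqr_ge0 (u 0 k)) sum0.
  by move/eqP; rewrite sqrf_eq0 => /eqP->; rewrite mxE.
(* The usual reflection 1 - 2 u^T u / (u u^T); the factor 2 cancels against u u^T = 2 (1 - v_0). *)
pose H := 1%:M - (1 - v 0 0)^-1 *: (u^T *m u).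
have HT : H^T = H by rewrite /H linearB /= trmx1 linearZ /= trmx_mul trmxK.
exists H; split.
  have WW : (u^T *m u) *m (u^T *m u) = (2 * (1 - v 0 0)) *: (u^T *m u).
    by rewrite mulmxA -[u^T *m u *m u^T]mulmxA uu mul_mx_scalar -scalemxAl.
  rewrite HT /H; move: (u^T *m u) WW => W WW.
  rewrite mulmxBl !mulmxBr !mul1mx mulmx1 -!scalemxAl -!scalemxAr WW.
  by apply/matrixP => i j; move: (1 - v 0 0) nz => c nz; rewrite !mxE; field.
rewrite rowE -/e0 /H mulmxBr mulmx1 -scalemxAr mulmxA eu mul_scalar_mx scalerA mulVf //.
by rewrite scale1r /u opprB addrC subrK.
Qed.

(** Deflation: in an orthonormal basis starting with a unit eigenvector, A becomes block diagonal,
    and induction applies to the lower block. *)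
Theorem symmetric_diagonalization (R : rcfType) n (A : 'M[R]_n) : A^T = A ->
  exists (Q : 'M[R]_n) (d : 'rV[R]_n),
    Q *m Q^T = 1%:M /\ A = Q^T *m diag_mx d *m Q.
Proof.
elim: n A => [|n IHn].
  by move=> A _; exists 0, 0; split; apply/matrixP => -[].
rewrite -[n.+1]add1n => A Asym.
have [x /eigenvalueP[w wA w_neq0]] := symmetric_eigenvalue (ltn0Sn n : (0 < 1 + n)%N) Asym.
pose s := \sum_j w 0 j ^+ 2.
have s_gt0 : 0 < s.
  rewrite lt_def sumr_ge0 ?andbT => [|i _]; last exact: sqr_ge0.
  apply: contra w_neq0 => /eqP s0; apply/eqP/rowP=> j; rewrite mxE; apply/eqP.
  by rewrite -sqrf_eq0 (psumr_eq0P (fun k _ => sqr_ge0 (w 0 k)) s0 (i := j)) .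
pose v := (Num.sqrt s)^-1 *: w.
have vA : v *m A = x *: v by rewrite /v -scalemxAl wA !scalerA mulrC.
have vv : v *m v^T = 1%:M.
  rewrite /v linearZ /= -scalemxAl -scalemxAr scalerA.
  have -> : w *m w^T = s%:M.
    apply/matrixP=> i j; rewrite !mxE !ord1 mulr1n; apply: eq_bigr => k _.
    by rewrite mxE expr2.
  rewrite scale_scalar_mx -invfM -expr2 sqr_sqrtr ?ltW // mulVf ?gt_eqF //.
have [H [HH Hv]] := @orthogonal_completion _ n v vv.
have H'H : H^T *m H = 1%:M by apply: mulmx1C.
pose B : 'M[R]_(1 + n) := H *m A *m H^T.
have Bsym : B^T = B by rewrite /B !trmx_mul trmxK Asym mulmxA.
have B0 : row 0 B = x *: delta_mx 0 0.
  rewrite /B !row_mul Hv vA -scalemxAl -Hv -row_mul HH.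
  by congr (_ *: _); rewrite rowE mulmx1.
have AB : A = H^T *m B *m H.
  by rewrite /B !mulmxA H'H mul1mx -mulmxA H'H mulmx1.
have Bij (i j : 'I_(1 + n)) : i = 0%N :> nat -> B i j = x *+ (j == 0%N :> nat).
  move=> i0; have -> : i = 0 by apply: val_inj.
  by have /rowP/(_ j) := B0; rewrite !mxE eqxx /= mulr_natr.
have Bul : ulsubmx B = x%:M.
  by apply/matrixP=> i j; rewrite !ord1 [LHS]mxE [LHS]mxE Bij // !mxE.
have Bur : ursubmx B = 0.
  by apply/matrixP=> i j; rewrite !ord1 [LHS]mxE [LHS]mxE Bij // !mxE.
have Bdl : dlsubmx B = 0 by rewrite -[LHS]trmxK trmx_dlsub Bsym Bur trmx0.
have drsym : (drsubmx B)^T = drsubmx B by rewrite trmx_drsub Bsym.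
have [Q [d [QQ Bd]]] := IHn _ drsym.
exists (block_mx 1%:M 0 0 Q *m H), (row_mx x%:M d); split.
  rewrite trmx_mul mulmxA -[_ *m H *m H^T]mulmxA HH mulmx1 tr_block_mx !trmx0 trmx1.
  by rewrite mulmx_block !mulmx0 !mul0mx !mulmx1 QQ !addr0 add0r -scalar_mx_block.
rewrite {1}AB trmx_mul -!mulmxA; congr (_ *m _); rewrite !mulmxA; congr (_ *m _).
rewrite diag_mx_row tr_block_mx !trmx0 trmx1 !mulmx_block !mulmx0 !mul0mx.
rewrite !mulmx1 !mul1mx !addr0 !add0r ?mulmx0 ?mul0mx ?addr0 ?add0r.
rewrite -Bd -[LHS]submxK Bul Bur Bdl; congr block_mx.
by apply/matrixP=> i j; rewrite !mxE !ord1.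
Qed.

(** * Spectrum and eigenprojectors read off a diagonalization *)

Lemma mup_prod_XsubC (F : fieldType) (s : seq F) x :
  mup x (\prod_(a <- s) ('X - a%:P)) = count_mem x s.
Proof.
elim: s => [|a s IHs]; first by rewrite big_nil mupNroot // root1.
rewrite big_cons mupM ?polyXsubC_eq0 //; last first.
  by rewrite prodf_seq_neq0; apply/allP=> b _ /=; rewrite polyXsubC_eq0.
by rewrite IHs -['X - _]expr1 mup_XsubCX /= eq_sym; case: eqP => _ /=.
Qed.

Lemma sorted_flatten_nseq d (T : orderType d) (s : seq T) (m : T -> nat) :
  sorted <%O s -> sorted <=%O (flatten [seq nseq (m x) x | x <- s]).
Proof.
rewrite (sorted_pairwise le_trans) (sorted_pairwise lt_trans).
elim: s => [//|a s IHs] /= /andP[/allP a_lt /IHs s_le].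
rewrite pairwise_cat s_le andbT; apply/andP; split.
  apply/allrelP => x y; rewrite mem_nseq => /andP[_ /eqP->] /flattenP[t /mapP[b bs ->]].
  by rewrite mem_nseq => /andP[_ /eqP->]; apply/ltW/a_lt.
by elim: (m a) => //= k ->; rewrite andbT; apply/allP=> y; rewrite mem_nseq => /andP[_ /eqP->].
Qed.

Section Diagonalization.
Variables (R : realType) (n : nat).
Implicit Types (A X Q : 'M[R]_n) (d : 'rV[R]_n).

Lemma conj_diagE Q d i j :
  (Q^T *m diag_mx d *m Q) i j = \sum_k d 0 k * Q k i * Q k j.
Proof.
rewrite mul_mx_diag mxE; apply: eq_bigr => k _; rewrite !mxE; ring.
Qed.

Lemma char_poly_conj_diag Q d : Q *m Q^T = 1%:M ->
  char_poly (Q^T *m diag_mx d *m Q) = \prod_(a <- [seq d 0 i | i : 'I_n]) ('X - a%:P).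
Proof.
move=> QQ; have Q'Q := mulmx1C QQ.
transitivity (char_poly (diag_mx d)); last first.
  rewrite char_poly_trig ?diag_mx_is_trig // big_image /=.
  by apply: eq_bigr => i _; rewrite mxE eqxx.
rewrite /char_poly /char_poly_mx.
pose p (B : 'M[R]_n) : 'M[{poly R}]_n := map_mx polyC B; rewrite -!/(p _).
(* Conjugation by Q fixes scalar matrices, so Q can be pulled out of X - A. *)
have {1}-> : ('X%:M : 'M[{poly R}]_n) = p Q^T *m 'X%:M *m p Q.
  by rewrite scalar_mxC -mulmxA /p -map_mxM Q'Q map_mx1 mulmx1.
rewrite /p !map_mxM -mulmxBl -mulmxBr !det_mulmx mulrAC -det_mulmx -map_mxM Q'Q.
by rewrite map_mx1 det1 mul1r.
Qed.

Lemma distinct_eigenvaluesP A x : (x \in distinct_eigenvalues A) = root (char_poly A) x.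
Proof.
by rewrite -(roots_on_rootsR (monic_neq0 (char_poly_monic A))) inE.
Qed.

Lemma spectrum_sorted A : sorted <=%R (spectrum A).
Proof. exact/sorted_flatten_nseq/sorted_roots. Qed.

(** Both lists contain each x as often as its multiplicity as a root of the characteristic
    polynomial. *)
Lemma perm_spectrum A Q d : Q *m Q^T = 1%:M -> A = Q^T *m diag_mx d *m Q ->
  perm_eq (spectrum A) [seq d 0 i | i : 'I_n].
Proof.
move=> QQ defA; apply/allP => x _ /=; apply/eqP.
rewrite -[RHS]mup_prod_XsubC -(char_poly_conj_diag _ QQ) -defA.
rewrite /spectrum count_flatten -map_comp sumnE big_map.
have [xr|xNr] := boolP (x \in distinct_eigenvalues A).
  rewrite (bigD1_seq x) ?uniq_roots //= count_nseq /= eqxx mul1n.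
  by rewrite big1 ?addn0 // => y yx; rewrite /= count_nseq /= (negPf yx).
rewrite big_seq big1 ?mupNroot -?distinct_eigenvaluesP // => y yr.
by rewrite /= count_nseq /=; case: eqP => // yx; rewrite yx (negPf xNr) in yr.
Qed.

Definition spectral_row A : 'rV[R]_n := \row_i (spectrum A)`_i.

(** Permuting the rows of Q puts the eigenbasis in the order of the sorted spectrum. *)
Theorem spectral_decomposition A : A^T = A ->
  size (spectrum A) = n /\
  exists Q, Q *m Q^T = 1%:M /\ A = Q^T *m diag_mx (spectral_row A) *m Q.
Proof.
move=> /symmetric_diagonalization[Q [d [QQ defA]]].
have perm := perm_spectrum QQ defA.
split; first by rewrite (perm_size perm) size_image card_ord.
have /tuple_permP[p defs] : perm_eq (spectrum A) [tuple d 0 i | i < n].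
  by rewrite /= -[X in perm_eq _ X]/(map _ _) -codomE.
exists (row_perm p Q); split.
  apply/matrixP => i j; have /matrixP/(_ (p i) (p j)) := QQ; rewrite !mxE.
  by rewrite (inj_eq perm_inj) => <-; apply: eq_bigr => k _; rewrite !mxE.
apply/matrixP => i j; rewrite {1}defA !conj_diagE (reindex_inj (@perm_inj _ p)) /=.
apply: eq_bigr => k _; rewrite !mxE; congr (_ * _ * _).
by rewrite defs (nth_map k) ?size_enum_ord // nth_ord_enum !tnth_mktuple.
Qed.

Lemma spectral_row_mono A : A^T = A ->
  forall i j : 'I_n, (i <= j)%N -> spectral_row A 0 i <= spectral_row A 0 j.
Proof.
move=> /spectral_decomposition[szA _] i j ij; rewrite !mxE.
by apply: (sorted_leq_nth le_trans lexx _ (spectrum_sorted A)); rewrite ?inE ?szA.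
Qed.

(** The right-hand side P has its rows in the eigenspace U and fixes U, and the rows of 1 - P are
    orthogonal to U; this determines the projection. *)
Lemma eigenprojectorE A Q d x : Q *m Q^T = 1%:M -> A = Q^T *m diag_mx d *m Q ->
  eigenprojector A x = Q^T *m diag_mx (\row_i (d 0 i == x)%:R) *m Q.
Proof.
move=> QQ defA; have Q'Q := mulmx1C QQ; set P := RHS.
rewrite /eigenprojector; set U := eigenspace A x.
have PT : P^T = P by rewrite /P !trmx_mul tr_diag_mx trmxK mulmxA.
have PU : (P <= U)%MS.
  apply/eigenspaceP; rewrite {1}defA /P !mulmxA -[_ *m Q *m Q^T]mulmxA QQ mulmx1.
  rewrite scalemxAl; congr (_ *m _); rewrite -mulmxA scalemxAr; congr (_ *m _).
  apply/matrixP=> i j; rewrite mul_diag_mx !mxE.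
  by case: (i =P j) => [_|_]; case: eqP => [->|_] /=;
    rewrite ?mulr1n ?mulr0n ?mulr1 ?mul1r ?mulr0 ?mul0r.
have UP : U *m P = U.
  have /eigenspaceP : (U <= U)%MS by []; rewrite defA => UA.
  have UAQ : (U *m Q^T) *m diag_mx d = x *: (U *m Q^T).
    by rewrite scalemxAl -UA !mulmxA -[_ *m Q *m Q^T]mulmxA QQ mulmx1.
  suff {2}<- : U *m Q^T *m diag_mx (\row_i (d 0 i == x)%:R) *m Q = U by rewrite /P !mulmxA.
  suff -> : U *m Q^T *m diag_mx (\row_i (d 0 i == x)%:R) = U *m Q^T.
    by rewrite -mulmxA Q'Q mulmx1.
  apply/matrixP=> i j; have /matrixP/(_ i j) := UAQ; rewrite !mul_mx_diag.
  move: (U *m Q^T) => W; rewrite !mxE; case: eqP => [_|/eqP dx]; rewrite ?mulr1 //.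
  move=> Wd; have /eqP : (d 0 j - x) * W i j = 0 by rewrite mulrBl mulrC Wd subrr.
  by rewrite mulf_eq0 subr_eq0 (negPf dx) /= mulr0 => /eqP->.
(* Rows of W lie in U, hence are fixed by P = P^T = U^T C'^T, yet they are killed by U^T. *)
have capUV : (U :&: kermx U^T = 0)%MS.
  apply/eqP; rewrite -submx0; set W := (_ :&: _)%MS.
  have /submxP[C defC] : (W <= U)%MS by rewrite capmxSl.
  have /submxP[C' defP] := PU.
  have /sub_kermxP WU0 : (W <= kermx U^T)%MS by rewrite capmxSr.
  have -> : W = W *m P by rewrite {2}defC -mulmxA UP -defC.
  by rewrite -PT defP trmx_mul mulmxA WU0 mul0mx submx0.
rewrite -[LHS]mul1mx -[1%:M](subrK P) mulmxDl addrC (proj_mx_id capUV) //.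
rewrite (proj_mx_0 capUV) ?addr0 //; apply/sub_kermxP.
by rewrite mulmxBl mul1mx -PT -trmx_mul UP subrr.
Qed.

End Diagonalization.

(** * Ky Fan's principle and its behaviour under perturbation *)

Section KyFan.
Variables (R : realType) (n : nat).
Implicit Types (A D X P Q : 'M[R]_n) (d : 'rV[R]_n).

(** The condition 0 <= X <= 1 in the Loewner order. *)
Definition contraction X :=
  forall v : 'rV[R]_n, 0 <= (v *m X *m v^T) 0 0 <= (v *m v^T) 0 0.

(** Eigenvalues are listed increasingly from index 0, so the k largest sit at the indices from n - k
    on. *)
Definition top_indicator k : 'rV[R]_n := \row_i (n - k <= i)%N%:R.

Definition top_sum k A : R := \sum_(i < n | (n - k <= i)%N) spectral_row A 0 i.

Lemma mxtrace_conj_diag Q d X :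
  \tr (X *m (Q^T *m diag_mx d *m Q)) = \sum_i d 0 i * (Q *m X *m Q^T) i i.
Proof.
rewrite !mulmxA mxtrace_mulC !mulmxA mul_mx_diag; apply: eq_bigr => i _.
by rewrite mxE mulrC.
Qed.

Lemma sum_top_indicator k : (k <= n)%N -> \sum_i top_indicator k 0 i = k%:R.
Proof.
move=> kn; under eq_bigr do rewrite mxE.
rewrite -natr_sum; congr _%:R.
rewrite -(big_mkord xpredT (fun i => nat_of_bool (n - k <= i)%N)).
rewrite /nat_of_bool -big_mkcond /=.
rewrite sum1_count.
have -> : index_iota 0 n = iota 0 (n - k) ++ iota (n - k) k.
  by rewrite -{2}[(n - k)%N]add0n -iotaD subnK // /index_iota subn0.
rewrite count_cat (eq_in_count (a2 := pred0)) ?count_pred0; last first.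
  by move=> i; rewrite mem_iota add0n => /andP[_]; rewrite ltnNge => /negPf.
rewrite (eq_in_count (a2 := predT)) ?count_predT ?size_iota // => i.
by rewrite mem_iota => /andP[].
Qed.

Lemma row_dot_diag (v : 'rV[R]_n) Q d :
  (v *m (Q^T *m diag_mx d *m Q) *m v^T) 0 0 = \sum_i d 0 i * (v *m Q^T) 0 i ^+ 2.
Proof.
rewrite !mulmxA -[_ *m Q *m v^T]mulmxA mul_mx_diag mxE; apply: eq_bigr => i _.
have -> : Q *m v^T = (v *m Q^T)^T by rewrite trmx_mul trmxK.
by move: (v *m Q^T) => u; rewrite !mxE mulrAC mulrC expr2.
Qed.

Lemma contraction_conj_diag Q d : Q *m Q^T = 1%:M ->
  (forall i, 0 <= d 0 i <= 1) -> contraction (Q^T *m diag_mx d *m Q).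
Proof.
move=> QQ d01 v; rewrite row_dot_diag.
have -> : (v *m v^T) 0 0 = \sum_i (v *m Q^T) 0 i ^+ 2.
  have := row_dot_diag v Q (const_mx 1).
  rewrite diag_const_mx mulmx1 (mulmx1C QQ) mulmx1 => ->.
  by apply: eq_bigr => i _; rewrite mxE mul1r.
rewrite sumr_ge0 => [|i _]; last by case/andP: (d01 i) => *; rewrite mulr_ge0 ?sqr_ge0.
by apply: ler_sum => i _; rewrite ler_piMl ?sqr_ge0 //; case/andP: (d01 i).
Qed.

Lemma mxtrace_conj_diag1 Q d : Q *m Q^T = 1%:M ->
  \tr (Q^T *m diag_mx d *m Q) = \sum_i d 0 i.
Proof. by move=> QQ; rewrite mxtrace_mulC mulmxA QQ mul1mx mxtrace_diag. Qed.

Lemma mul_conj_diag Q d d' : Q *m Q^T = 1%:M ->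
  (Q^T *m diag_mx d *m Q) *m (Q^T *m diag_mx d' *m Q) =
  Q^T *m diag_mx (\row_i (d 0 i * d' 0 i)) *m Q.
Proof.
move=> QQ; rewrite !mulmxA -[_ *m Q *m Q^T]mulmxA QQ mulmx1.
by rewrite -[Q^T *m _ *m _]mulmxA mulmx_diag.
Qed.

Lemma trmx_conj_diag Q d : (Q^T *m diag_mx d *m Q)^T = Q^T *m diag_mx d *m Q.
Proof. by rewrite !trmx_mul tr_diag_mx trmxK mulmxA. Qed.

(* Taking g = 0 gives Ky Fan's inequality. *)
Lemma ky_fan_gap A Q X k (g : R) : A^T = A -> Q *m Q^T = 1%:M ->
    A = Q^T *m diag_mx (spectral_row A) *m Q -> (0 < k <= n)%N -> 0 <= g ->
    (forall i j : 'I_n, (i < n - k)%N -> (n - k <= j)%N ->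
       spectral_row A 0 i + g <= spectral_row A 0 j) ->
    contraction X -> \tr X = k%:R ->
  \tr (X *m A) + g * (k%:R - \tr (X *m (Q^T *m diag_mx (top_indicator k) *m Q)))
    <= top_sum k A.
Proof.
move=> Asym QQ defA /andP[k_gt0 kn] g_ge0 gap Xc trX.
(* The diagonal y of X in an eigenbasis of A consists of weights in [0, 1] with sum k. *)
pose y i := (Q *m X *m Q^T) i i; pose T := top_indicator k; pose d := spectral_row A.
have y01 i : 0 <= y i <= 1.
  have /andP[] := Xc (row i Q).
  have yE (Y : 'M[R]_n) : (row i Q *m Y *m (row i Q)^T) 0 0 = (Q *m Y *m Q^T) i i.
    by rewrite -row_mul !mxE; apply: eq_bigr => j _; rewrite !mxE.
  by have := yE 1%:M; rewrite !mulmx1 QQ [1%:M i i]mxE eqxx => ->; rewrite yE -/(y i) => -> ->.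
have sum_y : \sum_i y i = k%:R.
  by rewrite -trX -(mulmx1 X) -(mulmx1C QQ) mulmxA mxtrace_mulC mulmxA.
have nk : (n - k < n)%N by rewrite ltn_subrL k_gt0 (leq_trans k_gt0).
(* The k-th largest eigenvalue. As T and y both sum to k, subtracting c from all eigenvalues changes
   nothing and makes the difference a sum of nonnegative terms. *)
pose c := d 0 (Ordinal nk).
have T_sum : top_sum k A = \sum_i T 0 i * d 0 i.
  rewrite /top_sum big_mkcond; apply: eq_bigr => i _.
  by rewrite [T 0 i]mxE; case: ifP; rewrite ?mul1r ?mul0r.
rewrite {1}defA !mxtrace_conj_diag -/d -/T T_sum -subr_ge0.
have -> : \sum_i T 0 i * d 0 i - (\sum_i d 0 i * y i + g * (k%:R - \sum_i T 0 i * y i))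
  = \sum_i ((T 0 i - y i) * (d 0 i - c) - g * (1 - T 0 i) * y i).
  transitivity (\sum_i T 0 i * d 0 i - (\sum_i d 0 i * y i + g * (\sum_i y i - \sum_i T 0 i * y i))
      - c * (\sum_i T 0 i - \sum_i y i)).
    by rewrite sum_y sum_top_indicator // subrr mulr0 subr0.
  rewrite -!sumrB !mulr_sumr -big_split -!sumrB /=; apply: eq_bigr => i _; ring.
apply: sumr_ge0 => i _; have /andP[y_ge0 y_le1] := y01 i; rewrite [T 0 i]mxE.
case: leqP => /= ki.
  rewrite subrr mulr0 mul0r subr0 mulr_ge0 ?subr_ge0 //.
  exact: spectral_row_mono.
(* Here T i = 0 and the term is y_i (c - d_i - g). *)
have := gap i (Ordinal nk) ki (leqnn _); rewrite -/d -/c => dc; nra.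
Qed.

Lemma top_indicator01 k i : 0 <= top_indicator k 0 i <= 1.
Proof. by rewrite mxE ler0n lern1 leq_b1. Qed.

Lemma ky_fan A X k : A^T = A -> (0 < k <= n)%N ->
  contraction X -> \tr X = k%:R -> \tr (X *m A) <= top_sum k A.
Proof.
move=> Asym kn Xc trX; have [_ [Q [QQ defA]]] := spectral_decomposition Asym.
have := ky_fan_gap Asym QQ defA kn (lexx 0) _ Xc trX; rewrite mul0r addr0; apply.
move=> i j ik kj; rewrite addr0; apply: spectral_row_mono => //.
exact: ltnW (leq_trans ik kj).
Qed.

(** The projector onto the top k eigenvectors attains the maximum in Ky Fan's principle. *)
Lemma top_sumE A Q k : Q *m Q^T = 1%:M -> A = Q^T *m diag_mx (spectral_row A) *m Q ->
  top_sum k A = \tr (Q^T *m diag_mx (top_indicator k) *m Q *m A).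
Proof.
move=> QQ defA; rewrite {2}defA mul_conj_diag // mxtrace_conj_diag1 //.
rewrite /top_sum big_mkcond; apply: eq_bigr => i _; rewrite !mxE.
by case: ifP; rewrite ?mul1r ?mul0r.
Qed.

(* The top projector P of A + tD satisfies |P - F|^2 = 2 (k - tr(PF)), where F is
   that of A.  The gap penalizes this quantity linearly in tr(PA), which absorbs
   the cross term t tr((P - F)D) up to O(t^2). *)
Lemma top_sum_perturbation A D Q k (g t : R) : A^T = A -> D^T = D -> Q *m Q^T = 1%:M ->
    A = Q^T *m diag_mx (spectral_row A) *m Q -> (0 < k <= n)%N -> 0 < g ->
    (forall i j : 'I_n, (i < n - k)%N -> (n - k <= j)%N ->
       spectral_row A 0 i + g <= spectral_row A 0 j) ->
  top_sum k (A + t *: D) <= top_sum k A +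
    t * \tr (Q^T *m diag_mx (top_indicator k) *m Q *m D) +
    t ^+ 2 / (2 * g) * \sum_i \sum_j D i j ^+ 2.
Proof.
move=> Asym Dsym QQ defA kn g_gt0 gap; set F := _ *m diag_mx _ *m Q.
have Bsym : (A + t *: D)^T = A + t *: D by rewrite linearD linearZ /= Asym Dsym.
have [_ [Q' [QQ' defB]]] := spectral_decomposition Bsym.
rewrite (top_sumE k QQ' defB); set P := _ *m diag_mx _ *m Q'.
have trT (Z : 'M[R]_n) : Z *m Z^T = 1%:M -> \tr (Z^T *m diag_mx (top_indicator k) *m Z) = k%:R.
  by move=> ZZ; case/andP: kn => _ kn; rewrite mxtrace_conj_diag1 // sum_top_indicator.
have idT (Z : 'M[R]_n) : Z *m Z^T = 1%:M ->
    let E := Z^T *m diag_mx (top_indicator k) *m Z in E *m E = E.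
  move=> ZZ /=; rewrite mul_conj_diag //; congr (_ *m diag_mx _ *m _).
  by apply/rowP=> i; rewrite !mxE -natrM mulnb andbb.
have Pc : contraction P by apply: contraction_conj_diag => // i; exact: top_indicator01.
have := ky_fan_gap Asym QQ defA kn (ltW g_gt0) gap Pc (trT _ QQ').
rewrite -/F => kf.
have distPF : \sum_i \sum_j (P - F) i j ^+ 2 = 2 * (k%:R - \tr (P *m F)).
  transitivity (\tr ((P - F) *m (P - F)^T)).
    by apply: eq_bigr => i _; rewrite [RHS]mxE; apply: eq_bigr => j _; rewrite [_^T _ _]mxE expr2.
  rewrite linearB /= !trmx_conj_diag -/P -/F mulmxBl !mulmxBr !linearB /=.
  rewrite (idT _ QQ') (idT _ QQ) !trT // [\tr (F *m P)]mxtrace_mulC; ring.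
(* Entrywise t a b <= (g/2) a^2 + t^2/(2g) b^2; the weight g/2 makes the first sum exactly the
   penalty in [kf]. *)
have am_gm : t * \tr ((P - F) *m D) <=
    g / 2 * (2 * (k%:R - \tr (P *m F))) + t ^+ 2 / (2 * g) * \sum_i \sum_j D i j ^+ 2.
  rewrite -distPF !mulr_sumr -big_split /=; apply: ler_sum => i _.
  rewrite [((P - F) *m D) i i]mxE !mulr_sumr -big_split /=; apply: ler_sum => j _.
  have -> : D j i = D i j by rewrite -{1}Dsym mxE.
  rewrite -subr_ge0; set a := (P - F) i j; set b := D i j.
  have -> : g / 2 * a ^+ 2 + t ^+ 2 / (2 * g) * b ^+ 2 - t * (a * b)
      = (g * a - t * b) ^+ 2 / (2 * g).
    by field; rewrite gt_eqF.
  by rewrite divr_ge0 ?sqr_ge0 // mulr_ge0 // ltW.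
rewrite mulmxDr -scalemxAr linearD linearZ /=.
by move: am_gm; rewrite mulmxBl linearB /=; lra.
Qed.

End KyFan.

Section SpectrumFacts.
Variables (R : realType) (n : nat).
Implicit Types (A X Q : 'M[R]_n).

Lemma mem_distinct_eigenvalues A x : A^T = A ->
  x \in distinct_eigenvalues A <-> exists i, spectral_row A 0 i = x.
Proof.
move=> /spectral_decomposition[_ [Q [QQ defA]]].
rewrite distinct_eigenvaluesP {1}defA char_poly_conj_diag // root_prod_XsubC.
split=> [/imageP[i _ ->]|[i <-]]; first by exists i.
exact: image_f.
Qed.

Lemma spectral_rowE A Q i : Q *m Q^T = 1%:M ->
  A = Q^T *m diag_mx (spectral_row A) *m Q -> spectral_row A 0 i = (Q *m A *m Q^T) i i.
Proof.
move=> QQ defA; rewrite {2}defA !mulmxA QQ mul1mx -mulmxA QQ mulmx1.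
by rewrite [RHS]mxE eqxx.
Qed.

Lemma conj_diag_entry A Q i : (Q *m A *m Q^T) i i = (row i Q *m A *m (row i Q)^T) 0 0.
Proof. by rewrite -row_mul !mxE; apply: eq_bigr => j _; rewrite !mxE. Qed.

Lemma sum_spectral_row A : A^T = A -> \sum_i spectral_row A 0 i = \tr A.
Proof.
move=> /spectral_decomposition[_ [Q [QQ defA]]].
by rewrite {2}defA mxtrace_conj_diag1.
Qed.

End SpectrumFacts.

(** * Weighted Laplacians and the reduction of total rigidity to top sums *)

Section Laplacians.
Variables (R : realType) (n : nat) (e : rel 'I_n).
Implicit Types (w u : {ffun edge e -> R}) (X Q : 'M[R]_n) (ab : edge e) (v : 'rV[R]_n).

Lemma laplacian_sym w : (laplacian w)^T = laplacian w.
Proof.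
rewrite /laplacian linear_sum; apply: eq_bigr => ab _.
by rewrite linearZ /= /edge_laplacian trmx_mul trmxK.
Qed.

Lemma src_neq_tgt ab : src ab != tgt ab.
Proof.
by rewrite /src /tgt; case: ab => -[a b] /= /andP[ab _]; rewrite -val_eqE /= ltn_eqF.
Qed.

(** Cyclicity turns the trace into z^T X z; this pairing makes [laplacian_adjoint] the adjoint of
    [laplacian]. *)
Lemma mxtrace_edge_laplacian X ab : X^T = X ->
  \tr (X *m edge_laplacian R ab) = laplacian_adjoint e X ab.
Proof.
move=> Xsym; rewrite /edge_laplacian mulmxA mxtrace_mulC mulmxA trace_mx11 ffunE.
rewrite /edge_vec [(_ - _)^T]linearB /= !trmx_delta mulmxBl -!rowE mulmxBr !mulmxBl -!colE.
rewrite !mxE.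
have -> : X (tgt ab) (src ab) = X (src ab) (tgt ab) by rewrite -{1}Xsym mxE.
ring.
Qed.

Lemma mxtrace_laplacian X w : X^T = X ->
  \tr (X *m laplacian w) = \sum_ab w ab * laplacian_adjoint e X ab.
Proof.
move=> Xsym; rewrite /laplacian mulmx_sumr linear_sum; apply: eq_bigr => ab _ /=.
by rewrite -scalemxAr linearZ /= mxtrace_edge_laplacian.
Qed.

Lemma laplacian_quadratic_form w v :
  (v *m laplacian w *m v^T) 0 0 = \sum_ab w ab * (v 0 (src ab) - v 0 (tgt ab)) ^+ 2.
Proof.
(* The form is the trace of L(w) against the rank-one matrix v^T v. *)
rewrite -trace_mx11 mxtrace_mulC mulmxA mxtrace_laplacian; last first.
  by rewrite trmx_mul trmxK.
apply: eq_bigr => ab _; rewrite ffunE.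
have E i j : (v^T *m v) i j = v 0 i * v 0 j by rewrite mxE big_ord1 mxE.
rewrite !E; ring.
Qed.

(** Each edge contributes |z_ab|^2 = 2. The constant trace lets sums of smallest eigenvalues be
    traded for sums of largest ones. *)
Lemma mxtrace_laplacian_simplex w : weight_simplex w ->
  \tr (laplacian w) = 2 * #|{: edge e}|%:R.
Proof.
case=> _ sumw; rewrite -[laplacian w]mul1mx mxtrace_laplacian ?trmx1 //.
rewrite -sumw mulr_sumr; apply: eq_bigr => ab _; rewrite ffunE !mxE !eqxx.
by rewrite (negPf (src_neq_tgt ab)) /=; ring.
Qed.

Lemma all_ones_simplex : weight_simplex (all_ones R e).
Proof.
split=> [ab|]; first by rewrite ffunE.
under eq_bigr do rewrite ffunE.
by rewrite sumr_const.
Qed.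

Lemma spectral_row_laplacian_ge0 w i : (forall ab, 0 <= w ab) ->
  0 <= spectral_row (laplacian w) 0 i.
Proof.
move=> w_ge0; have [_ [Q [QQ defL]]] := spectral_decomposition (laplacian_sym w).
rewrite (spectral_rowE i QQ defL) conj_diag_entry laplacian_quadratic_form.
by apply: sumr_ge0 => ab _; rewrite mulr_ge0 ?sqr_ge0.
Qed.

(** The all-ones vector has form 0, a sum of nonnegative terms d_i x_i^2 with some x_i nonzero; that
    d_i is 0 and squeezes the least eigenvalue. *)
Lemma spectral_row_laplacian0 w (i0 : 'I_n) : (forall ab, 0 <= w ab) -> i0 = 0%N :> nat ->
  spectral_row (laplacian w) 0 i0 = 0.
Proof.
move=> w_ge0 i0_0; have [_ [Q [QQ defL]]] := spectral_decomposition (laplacian_sym w).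
pose v : 'rV[R]_n := const_mx 1.
have : (v *m laplacian w *m v^T) 0 0 = 0.
  by rewrite laplacian_quadratic_form big1 // => ab _; rewrite !mxE subrr expr0n mulr0.
rewrite {1}defL row_dot_diag => sum0.
have terms_ge0 i (_ : true) :=
  mulr_ge0 (spectral_row_laplacian_ge0 i w_ge0) (sqr_ge0 ((v *m Q^T) 0 i)).
have terms0 i := psumr_eq0P terms_ge0 sum0 (i := i) isT.
have [i vi] : exists i, (v *m Q^T) 0 i != 0.
  apply/existsP; apply: contraT; rewrite negb_exists => /forallP v0.
  have vQ0 : v *m Q^T = 0.
    by apply/rowP => i; rewrite [RHS]mxE; apply/eqP; rewrite -[_ == _]negbK v0.
  have : v = 0 by rewrite -[v]mulmx1 -(mulmx1C QQ) mulmxA vQ0 mul0mx.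
  by move=> /rowP/(_ i0)/eqP; rewrite !mxE oner_eq0.
have /eqP := terms0 i; rewrite mulf_eq0 sqrf_eq0 (negPf vi) orbF => /eqP di.
apply/le_anti; rewrite spectral_row_laplacian_ge0 // andbT -di.
by apply: spectral_row_mono; [exact: laplacian_sym | rewrite i0_0].
Qed.

Lemma sum_spectrum_interval w m :
  \sum_(m <= i < n) (spectrum (laplacian w))`_i =
  \sum_(i < n | (m <= i)%N) spectral_row (laplacian w) 0 i.
Proof. by rewrite big_geq_mkord; apply: eq_bigr => i _; rewrite mxE. Qed.

Lemma sum_largestE k w : sum_largest k w = top_sum k (laplacian w).
Proof. by rewrite /sum_largest big_add1 sum_spectrum_interval. Qed.

Lemma sum_smallestE k w : weight_simplex w -> (k < n)%N ->
  sum_smallest k w = 2 * #|{: edge e}|%:R - top_sum (n.-1 - k) (laplacian w).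
Proof.
move=> w_s kn; rewrite -(mxtrace_laplacian_simplex w_s) -(sum_spectral_row (laplacian_sym w)).
have -> : \sum_i spectral_row (laplacian w) 0 i = \sum_(0 <= i < n) (spectrum (laplacian w))`_i.
  by rewrite sum_spectrum_interval; apply: eq_bigl => i; rewrite leq0n.
have n_gt0 : (0 < n)%N by exact: leq_ltn_trans kn.
have -> : top_sum (n.-1 - k) (laplacian w) = \sum_(k.+1 <= i < n) (spectrum (laplacian w))`_i.
  by rewrite sum_spectrum_interval; apply: eq_bigl => i; congr (_ <= _)%N; lia.
(* The trace splits into the eigenvalue 0 at index 0, the next k at indices 1 to k, and the n - 1 -
   k largest; [lambda] counts from 1. *)
rewrite (@big_cat_nat _ _ _ k.+1) //= addrK big_nat_recl //.
have := spectral_row_laplacian0 (i0 := Ordinal n_gt0) (proj1 w_s) erefl.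
by rewrite mxE /= => ->; rewrite add0r /sum_smallest 2!big_add1.
Qed.

Lemma totally_conformally_rigidP : totally_conformally_rigid R e <->
  (forall k w, (0 < k < n)%N -> weight_simplex w ->
     top_sum k (laplacian (all_ones R e)) <= top_sum k (laplacian w)).
Proof.
split=> [rigid k w kn w_s|rigid k kn w w' w_s w'_s].
  have kn' : (1 <= k <= n.-1)%N by lia.
  by have [_] := rigid k kn' w w w_s w_s; rewrite !sum_largestE.
have kn' : (0 < k < n)%N by lia.
split; last by rewrite !sum_largestE; exact: rigid.
rewrite !sum_smallestE //; try lia; try exact: all_ones_simplex.
(* For k = n - 1 both complementary top sums are empty. *)
rewrite lerD2l lerN2; have [k'0|k'_gt0] := posnP (n.-1 - k).
  by rewrite k'0 /top_sum subn0 !big1 // => i; rewrite leqNgt ltn_ord.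
by apply: rigid => //; lia.
Qed.

End Laplacians.

(** * Edge-rigidity and minimality of the top sums *)

Lemma ge0_of_first_order (R : realFieldType) (a c : R) : 0 <= c ->
  (forall t, 0 < t -> t <= 1 -> 0 <= t * a + t ^+ 2 * c) -> 0 <= a.
Proof.
move=> c_ge0 H; rewrite leNgt; apply/negP => a_lt0.
(* If a < 0, then t = -a / (c - a + 1) lies in (0, 1] and gives a + t c = -t (1 - a) < 0. *)
have s_gt0 : 0 < c - a + 1 by lra.
have t_gt0 : 0 < - a / (c - a + 1) by rewrite divr_gt0 // oppr_gt0.
have := H _ t_gt0; rewrite ler_pdivrMr // mul1r => /(_ ltac:(lra)).
set t := _ / _ in t_gt0 *; rewrite expr2 -mulrA -mulrDr pmulr_rge0 // => {}H.
have ts : t * (c - a + 1) = - a by rewrite /t divfK ?gt_eqF.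
nra.
Qed.

Section EdgeRigidity.
Variables (R : realType) (n : nat) (e : rel 'I_n).
Implicit Types (w u : {ffun edge e -> R}) (X Q : 'M[R]_n) (ab cd : edge e).
Let L : 'M[R]_n := laplacian (all_ones R e).

Lemma laplacian_ones_sym : L^T = L.
Proof. exact: laplacian_sym. Qed.

(* The sum of the c_i over an eigenvalue class of L is tr(E_x L(w)), which for
   x > 0 does not depend on w by edge-rigidity.  For x = 0 the vectors in the
   kernel of L are also in the kernel of L(w). *)
Lemma edge_rigid_class_sum Q w x : edge_rigid R e ->
    Q *m Q^T = 1%:M -> L = Q^T *m diag_mx (spectral_row L) *m Q ->
    weight_simplex w ->
  \sum_(i | spectral_row L 0 i == x) (Q *m laplacian w *m Q^T) i i
    = \sum_(i | spectral_row L 0 i == x) spectral_row L 0 i.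
Proof.
move=> rigid QQ defL [w_ge0 sum_w].
have ones_ge0 ab : 0 <= all_ones R e ab by rewrite ffunE.
have [->|x_neq0] := eqVneq x 0.
  rewrite [RHS]big1 ?big1 // => i /eqP di0 //.
  rewrite conj_diag_entry laplacian_quadratic_form big1 // => ab _.
  (* The form of L at q_i is a vanishing sum of squares, so q_i takes equal values at the two ends
     of every edge. *)
  move: di0; rewrite (spectral_rowE i QQ defL) conj_diag_entry laplacian_quadratic_form.
  move=> /(psumr_eq0P (fun ab _ => mulr_ge0 (ones_ge0 ab) (sqr_ge0 _)))/(_ ab isT).
  by rewrite ffunE mul1r => ->; rewrite mulr0.
have [/existsP[j /eqP dj]|] := boolP [exists j, spectral_row L 0 j == x]; last first.
  by rewrite negb_exists => /forallP no; rewrite !big_pred0 // => i; apply/negbTE.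
pose s := distinct_eigenvalues L.
have x_s : x \in s by apply/(mem_distinct_eigenvalues _ laplacian_ones_sym); exists j.
have n_gt0 : (0 < n)%N by exact: leq_ltn_trans (ltn_ord j).
have d0 := spectral_row_laplacian0 (i0 := Ordinal n_gt0) ones_ge0 erefl.
have s0 : 0 \in s by apply/(mem_distinct_eigenvalues _ laplacian_ones_sym); eexists; exact: d0.
have s_sorted : sorted <=%R s by apply: (sub_sorted (@ltW _ _)); exact: sorted_roots.
(* 0 is an eigenvalue and none is negative, so 0 heads the list and x > 0 falls in the range of
   [edge_rigid]. *)
have ix_gt0 : (0 < index x s)%N.
  rewrite lt0n; apply: contra x_neq0 => /eqP ix0.
  rewrite eq_le -{2}dj spectral_row_laplacian_ge0 // andbT.
  rewrite -(nth_index 0 x_s) -[leRHS](nth_index 0 s0) ix0.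
  by rewrite (sorted_leq_nth le_trans lexx) // inE ?index_mem // -ix0 index_mem.
have [|g [g_gt0]] := rigid (index x s).+1; first by rewrite ltnS ix_gt0 index_mem.
rewrite /distinct_lambda /= nth_index // (eigenprojectorE _ QQ defL) => adjE.
set E := _ *m _ *m Q in adjE.
have trE u : \sum_ab u ab = #|{: edge e}|%:R ->
    \sum_(i | spectral_row L 0 i == x) (Q *m laplacian u *m Q^T) i i = g * #|{: edge e}|%:R.
  move=> sum_u; transitivity (\tr (E *m laplacian u)).
    rewrite mxtrace_mulC mxtrace_conj_diag big_mkcond; apply: eq_bigr => i _.
    by rewrite [X in X * _]mxE; case: ifP; rewrite ?mul1r ?mul0r.
  rewrite mxtrace_laplacian ?trmx_conj_diag // adjE -sum_u mulr_sumr.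
  by apply: eq_bigr => ab _; rewrite !ffunE mulr1 mulrC.
(* The all-ones weight has the same class sum, and its diagonal entries are the eigenvalues of L. *)
rewrite trE // -(trE (all_ones R e)); last by case: (all_ones_simplex R e).
by apply: eq_bigr => i _; rewrite -(spectral_rowE i QQ defL).
Qed.

(* Averaging over eigenvalue classes is doubly stochastic and maps the diagonal
   c of L(w), in an eigenbasis of L, to the spectrum of L. *)
Lemma top_sum_edge_rigid k w : edge_rigid R e -> (0 < k <= n)%N ->
  weight_simplex w -> top_sum k L <= top_sum k (laplacian w).
Proof.
move=> rigid kn w_s; have [_ [Q [QQ defL]]] := spectral_decomposition laplacian_ones_sym.
pose d i := spectral_row L 0 i; pose c i := (Q *m laplacian w *m Q^T) i i.
pose T := top_indicator R n k; pose m i : R := \sum_(j | d j == d i) 1.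
have m_gt0 i : 0 < m i.
  by rewrite /m (bigD1 i) //= ltr_pwDl // sumr_ge0.
have sum_ind i : \sum_j (d j == d i)%:R = m i.
  by rewrite /m [RHS]big_mkcond; apply: eq_bigr => j _; case: eqP.
have mE i j : d j = d i -> m j = m i by rewrite /m => ->.
have avg i : (\sum_(j | d j == d i) c j) / m i = d i.
  rewrite (edge_rigid_class_sum _ rigid QQ defL w_s).
  rewrite (eq_bigr (fun=> d i * 1)) => [|j /eqP->]; last by rewrite mulr1.
  by rewrite -mulr_sumr -/(m i) mulfK // lt0r_neq0.
(* T averaged over eigenvalue classes. Averaging is symmetric, so pairing y with c equals pairing T
   with the averaged c, which is d. *)
pose y : 'rV[R]_n := \row_j \sum_i T 0 i * (d j == d i)%:R / m i.
have T01 i : 0 <= T 0 i <= 1 by exact: top_indicator01.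
have y01 j : 0 <= y 0 j <= 1.
  rewrite mxE; apply/andP; split.
    apply: sumr_ge0 => i _; have /andP[T0 _] := T01 i.
    by rewrite divr_ge0 ?mulr_ge0 ?ler0n // ltW.
  (* Bounding T by 1 leaves a row sum of the averaging matrix, which is 1. *)
  apply: (@le_trans _ _ (\sum_i (d i == d j)%:R / m j)); last first.
    by rewrite -mulr_suml sum_ind divff // lt0r_neq0.
  apply: ler_sum => i _; rewrite eq_sym; case: eqP => [dij|_] /=; last by rewrite mulr0 !mul0r.
  have /andP[_ T1] := T01 i.
  by rewrite (mE _ _ dij) mulr1 ler_pM2r // invr_gt0.
have sum_y : \sum_j y 0 j = k%:R.
  rewrite -(@sum_top_indicator R n k); last by case/andP: kn.
  under eq_bigr do rewrite mxE.
  rewrite exchange_big; apply: eq_bigr => i _ /=.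
  rewrite -mulr_suml -mulr_sumr -mulrA -[RHS]mulr1; congr (_ * _).
  by rewrite sum_ind divff // lt0r_neq0.
have -> : top_sum k L = \tr (Q^T *m diag_mx y *m Q *m laplacian w).
  rewrite mxtrace_mulC mxtrace_conj_diag -/d.
  have -> : top_sum k L = \sum_i T 0 i * d i.
    rewrite /top_sum big_mkcond; apply: eq_bigr => i _.
    by rewrite [T 0 i]mxE; case: ifP; rewrite ?mul1r ?mul0r.
  under eq_bigr => i _ do rewrite -avg mulr_suml mulr_sumr big_mkcond.
  rewrite exchange_big /=; apply: eq_bigr => j _.
  rewrite -/(c j) [y 0 j]mxE mulr_suml; apply: eq_bigr => i _.
  by case: eqP => _; rewrite ?mulr1 ?mulr0 ?mul0r // -!mulrA [c j / _]mulrC.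
apply: ky_fan => //; first exact: laplacian_sym.
  exact: contraction_conj_diag.
by rewrite mxtrace_conj_diag1.
Qed.

Lemma laplacianD_scale w u t :
  laplacian [ffun ab => w ab + t * u ab] = laplacian w + t *: laplacian u.
Proof.
rewrite /laplacian scaler_sumr -big_split; apply: eq_bigr => ab _ /=.
by rewrite ffunE scalerDl scalerA.
Qed.

Definition top_minimal k := forall w, weight_simplex w -> top_sum k L <= top_sum k (laplacian w).

(** Moving weight t from ab to cd raises the top sum by at most t times the difference of the two
    adjoint entries, plus O(t^2). Minimality makes this difference nonnegative, and ab and cd can be
    exchanged. *)
Lemma top_minimal_adjoint_const Q k : Q *m Q^T = 1%:M ->
    L = Q^T *m diag_mx (spectral_row L) *m Q -> (0 < k < n)%N ->
    (forall i j : 'I_n, (i < n - k)%N -> (n - k <= j)%N ->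
       spectral_row L 0 i < spectral_row L 0 j) -> top_minimal k ->
  forall ab cd,
    laplacian_adjoint e (Q^T *m diag_mx (top_indicator R n k) *m Q) ab =
    laplacian_adjoint e (Q^T *m diag_mx (top_indicator R n k) *m Q) cd.
Proof.
move=> QQ defL kn gap min.
suff le ab cd : laplacian_adjoint e (Q^T *m diag_mx (top_indicator R n k) *m Q) ab <=
    laplacian_adjoint e (Q^T *m diag_mx (top_indicator R n k) *m Q) cd.
  by move=> ab cd; apply/le_anti; rewrite !le.
have lt1 : (n - k < n)%N by lia.
have lt2 : ((n - k).-1 < n)%N by lia.
(* By sortedness, the gap between the two eigenvalues adjacent to the cut is the smallest one across
   it. *)
pose g := spectral_row L 0 (Ordinal lt1) - spectral_row L 0 (Ordinal lt2).
have g_gt0 : 0 < g by rewrite subr_gt0 gap //=; lia.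
have g_gap (i j : 'I_n) : (i < n - k)%N -> (n - k <= j)%N ->
    spectral_row L 0 i + g <= spectral_row L 0 j.
  move=> ik kj.
  have := spectral_row_mono laplacian_ones_sym (i := Ordinal lt1) (j := j) kj.
  have : (i <= Ordinal lt2)%N by rewrite /=; lia.
  move=> /(spectral_row_mono laplacian_ones_sym); rewrite /g; lra.
have kn' : (0 < k <= n)%N by lia.
pose u : {ffun edge e -> R} := [ffun x => (x == cd)%:R - (x == ab)%:R].
have sum_u F : \sum_x u x * F x = F cd - F ab.
  under eq_bigr => x _ do rewrite ffunE mulrBl.
  rewrite sumrB; congr (_ - _).
    by rewrite (bigD1 cd) //= eqxx mul1r big1 ?addr0 // => x /negPf->; rewrite mul0r.
  by rewrite (bigD1 ab) //= eqxx mul1r big1 ?addr0 // => x /negPf->; rewrite mul0r.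
rewrite -subr_ge0 -sum_u -mxtrace_laplacian ?trmx_conj_diag //.
set D := laplacian u; have Dsym : D^T = D by exact: laplacian_sym.
apply: (@ge0_of_first_order _ _ ((2 * g)^-1 * \sum_i \sum_j D i j ^+ 2)).
  apply: mulr_ge0; first by rewrite invr_ge0 mulr_ge0 // ltW.
  by apply: sumr_ge0 => i _; apply: sumr_ge0 => j _; exact: sqr_ge0.
move=> t t_gt0 t_le1.
have w_s : weight_simplex [ffun x => all_ones R e x + t * u x].
  split=> [x|].
    by rewrite !ffunE; case: eqP => _; case: eqP => _ /=; lra.
  under eq_bigr do rewrite ffunE.
  rewrite big_split /= -mulr_sumr (proj2 (all_ones_simplex R e)).
  have := sum_u (fun=> 1); under eq_bigr do rewrite mulr1.
  by move=> ->; rewrite subrr mulr0 addr0.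
have := min _ w_s; rewrite laplacianD_scale -/L -/D => le1.
have := top_sum_perturbation t laplacian_ones_sym Dsym QQ defL kn' g_gt0 g_gap.
by rewrite -[_ / _ * _]mulrA => le2; move: (le_trans le1 le2); rewrite -addrA lerDl.
Qed.

Lemma laplacian_adjointB X Y ab :
  laplacian_adjoint e (X - Y) ab = laplacian_adjoint e X ab - laplacian_adjoint e Y ab.
Proof. by rewrite !ffunE !mxE; ring. Qed.

Lemma top_minimal_edge_rigid : (exists ab : edge e, True) ->
  (forall k, (0 < k < n)%N -> top_minimal k) -> edge_rigid R e.
Proof.
move=> [ab0 _] min i /andP[i_ge2 i_le].
have [szL [Q [QQ defL]]] := spectral_decomposition laplacian_ones_sym.
rewrite -/L in i_le *; set x := distinct_lambda _ _ _.
pose s := distinct_eigenvalues L; have i_lt : (i.-1 < size s)%N by rewrite /s; lia.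
have ones_ge0 ab : 0 <= all_ones R e ab by rewrite ffunE.
have x_s : x \in s by exact: mem_nth.
have /(mem_distinct_eigenvalues _ laplacian_ones_sym)[j0 dj0] := x_s.
have n_gt0 : (0 < n)%N by exact: leq_ltn_trans (ltn_ord j0).
have x_gt0 : 0 < x.
  apply: (@le_lt_trans _ _ s`_0).
    have /(mem_distinct_eigenvalues _ laplacian_ones_sym)[j <-] : s`_0 \in s.
      by apply: mem_nth; exact: leq_ltn_trans i_lt.
    exact: spectral_row_laplacian_ge0.
  apply: (sorted_ltn_nth lt_trans); rewrite ?inE ?(leq_ltn_trans _ i_lt) //; last by lia.
  exact: sorted_roots.
(* The indices of the eigenvalue x are those k with a <= k < b. Cutting at a or at b gives the
   projectors for eigenvalues >= x and > x. *)
pose a := count (< x) (spectrum L); pose b := count (<= x) (spectrum L).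
have L_sorted := spectrum_sorted L.
have dE (k : 'I_n) : spectral_row L 0 k = (spectrum L)`_k by rewrite mxE.
have aP (k : 'I_n) : (a <= k)%N = (x <= spectral_row L 0 k).
  rewrite dE; case: leqP => ak; first by rewrite nth_count_ge // szL ak ltn_ord.
  by rewrite leNgt nth_count_lt.
have bP (k : 'I_n) : (b <= k)%N = (x < spectral_row L 0 k).
  rewrite dE; case: leqP => ak; first by rewrite nth_count_gt // szL ak ltn_ord.
  by rewrite ltNge nth_count_le.
(* The eigenvalue 0 lies below x, so fewer than n eigenvalues are above the cut, as the minimality
   hypothesis demands. *)
have a_gt0 : (0 < a)%N.
  have := aP (Ordinal n_gt0).
  by rewrite (spectral_row_laplacian0 ones_ge0) // leNgt x_gt0 /= leqn0 lt0n => ->.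
have an : (a <= n)%N by rewrite -szL count_size.
have bn : (b <= n)%N by rewrite -szL count_size.
have b_gt0 : (0 < b)%N.
  by apply: leq_trans a_gt0 _; apply: sub_count => z /=; exact: ltW.
pose F k := Q^T *m diag_mx (top_indicator R n k) *m Q.
have F_const c : (0 < c <= n)%N ->
    (forall i j : 'I_n, (i < c)%N -> (c <= j)%N -> spectral_row L 0 i < spectral_row L 0 j) ->
    forall ab cd, laplacian_adjoint e (F (n - c)%N) ab = laplacian_adjoint e (F (n - c)%N) cd.
  (* The cut c = n arises from b when x is the largest eigenvalue; nothing lies above it and the
     projector is 0. *)
  move=> /andP[c_gt0 cn] gap; have [cn'|c_lt] := eqVneq c n.
    have -> : F (n - c)%N = 0; last by move=> ab cd; rewrite !ffunE !mxE.
    rewrite /F; have -> : top_indicator R n (n - c) = 0.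
      by apply/rowP => j; rewrite !mxE cn' subnn subn0 leqNgt ltn_ord.
    by rewrite linear0 mulmx0 mul0mx.
  have kn : (0 < n - c < n)%N by lia.
  by apply: top_minimal_adjoint_const => //; rewrite ?subKn //; exact: min.
have Fa := F_const a; have {F_const}Fb := F_const b.
have projE : eigenprojector L x = F (n - a)%N - F (n - b)%N.
  rewrite (eigenprojectorE _ QQ defL) /F -mulmxBl -mulmxBr -linearB /=.
  congr (_ *m diag_mx _ *m _); apply/rowP => k.
  by rewrite !mxE !subKn // aP bP dE; case: ltgtP => _ /=; rewrite ?subrr ?subr0.
have adjE ab : laplacian_adjoint e (eigenprojector L x) ab =
    laplacian_adjoint e (eigenprojector L x) ab0.
  rewrite projE !laplacian_adjointB; congr (_ - _).
  - apply: Fa; first by rewrite a_gt0.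
    by move=> k l; rewrite ltnNge !aP -ltNge; exact: lt_le_trans.
  - apply: Fb; first by rewrite b_gt0.
    by move=> k l; rewrite ltnNge !bP -leNgt; exact: le_lt_trans.
exists (laplacian_adjoint e (eigenprojector L x) ab0); split; last first.
  by apply/ffunP => ab; rewrite adjE [RHS]ffunE [all_ones _ _ _]ffunE mulr1.
have projsym : (eigenprojector L x)^T = eigenprojector L x.
  by rewrite (eigenprojectorE _ QQ defL) trmx_conj_diag.
(* Positivity of gamma: this trace is |E| gamma, and also x times its multiplicity. *)
have trE : \tr (eigenprojector L x *m L) =
    #|{: edge e}|%:R * laplacian_adjoint e (eigenprojector L x) ab0.
  rewrite mxtrace_laplacian // mulr_natl -sumr_const; apply: eq_bigr => ab _.
  by rewrite adjE ffunE mul1r.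
have : 0 < \tr (eigenprojector L x *m L).
  rewrite (eigenprojectorE _ QQ defL) {2}defL mul_conj_diag // mxtrace_conj_diag1 //.
  rewrite (bigD1 j0) //= ltr_pwDl //.
    by rewrite !mxE -dE dj0 eqxx mul1r.
  apply: sumr_ge0 => k _; rewrite [X in 0 <= X]mxE mulr_ge0 ?spectral_row_laplacian_ge0 //.
  by rewrite mxE ler0n.
by rewrite trE pmulr_rgt0 // ltr0n; apply/card_gt0P; exists ab0.
Qed.

End EdgeRigidity.

Theorem mainTheorem2 (R : realType) (n : nat) (e : rel 'I_n)
    (e_sym : symmetric e) (e_irr : irreflexive e)
    (e_conn : forall a b : 'I_n, connect e a b)
    (e_edge : exists a b : 'I_n, e a b) :
  totally_conformally_rigid R e <-> edge_rigid R e.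
Proof.
rewrite totally_conformally_rigidP; split=> [min | rigid k w kn w_s]; last first.
  by apply: top_sum_edge_rigid => //; lia.
apply: top_minimal_edge_rigid => [|k kn w]; last exact: min.
have [a [b eab]] := e_edge.
(* Elements of [edge] have increasing endpoints, so the given edge may have to be reversed. *)
have [ab|ba|ab] := ltngtP a b.
- have abP : (a < b)%N && e a b by rewrite ab.
  by exists (exist _ (a, b) abP).
- have baP : (b < a)%N && e b a by rewrite ba e_sym.
  by exists (exist _ (b, a) baP).
- by move: eab; rewrite (val_inj ab) e_irr.
Qed.
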